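(* In the setting described in the context, assume $\Delta_1>0$. Let $\beta_t$ ($t\ge1$) be the policy computed by LPSM at slot $t$, and let $Z=\inf\{z\ge 1:\ \beta_t=\beta^*\text{ for all }t\ge z\}$ (with $\inf\emptyset=\infty$) be the first slot from which on LPSM never fails to find the optimal policy. Then $\mathbb{E}[Z]<\infty$.
   Context: Setting (MDP with unknown mean rewards). $\mathcal{S}$ is a finite state space and $\mathcal{A}$ a finite action set, with $S=|\mathcal{S}|$, $A=|\mathcal{A}|$; for each $s\in\mathcal{S}$ a nonempty set $\mathcal{A}_s\subseteq\mathcal{A}$ of allowed actions is given. The transition probabilities $P(s'\mid s,a)$ are known to the agent. The MDP is ergodic: every deterministic stationary policy $\beta:\mathcal{S}\to\mathcal{A}$ with $\beta(s)\in\mathcal{A}_s$ induces an irreducible aperiodic Markov chain; let $\pi_\beta$ be its stationary distribution. Let $X_0,X_1,\dots$ be i.i.d. random variables with support $\mathcal{X}$. If at slot $t$ the state is $s_t$ and action $a_t\in\mathcal{A}_{s_t}$ is taken, the agent receives reward $r_t=f(s_t,a_t,X_t)$ with $f$ known to the agent, the next state is drawn from $P(\cdot\mid s_t,a_t)$, and after slot $t$ the agent learns the realization $x_t$ of $X_t$. Let $\mu(s,a)=\mathbb{E}[f(s,a,X)]$, $\mathbf{M}$ the matrix of the $\mu(s,a)$, and $\rho(\beta,\Theta)=\sum_s\pi_\beta(s)\Theta(s,\beta(s))$ for a matrix $\Theta$. Let $\beta^*$ be an optimal deterministic stationary policy, $\rho^*=\rho(\beta^*,\mathbf{M})=\max_\beta\rho(\beta,\mathbf{M})$,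 $\Delta_1=\rho^*-\max_{\beta\ne\beta^*}\rho(\beta,\mathbf{M})$. Assume $\sup_{x\in\mathcal{X}}f(s,a,x)-\inf_{x\in\mathcal{X}}f(s,a,x)$ is finite for all $(s,a)$. LP$(\Theta)$: maximize $\sum_{s}\sum_{a\in\mathcal{A}_s}\pi(s,a)\Theta(s,a)$ subject to $\pi(s,a)\ge 0$, $\sum_s\sum_{a\in\mathcal{A}_s}\pi(s,a)=1$, and $\sum_{a\in\mathcal{A}_{s'}}\pi(s',a)=\sum_s\sum_{a\in\mathcal{A}_s}\pi(s,a)P(s'\mid s,a)$ for all $s'$. Algorithm LPSM: at slot $0$ play any allowed action. At each slot $n\ge1$, let $\Theta_n(s,a)=\frac1n\sum_{k=0}^{n-1}f(s,a,x_k)$, solve LP$(\Theta_n)$ to obtain $\pi_{(n)}$, define $\beta_n(s)\in\arg\max_{a\in\mathcal{A}_s}\pi_{(n)}(s,a)$, and play $\beta_n(s_n)$. *)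

(* Defs.v *)
From HB Require Import structures.
From mathcomp Require Import all_boot all_order all_algebra.
From mathcomp Require Import all_classical all_reals all_analysis.
From mathcomp Require Import lebesgue_measure measurable_realfun.
Set Implicit Arguments. Unset Strict Implicit. Unset Printing Implicit Defensive.
Import Order.TTheory GRing.Theory Num.Theory.
Local Open Scope ring_scope.
Local Open Scope classical_set_scope.

Section MDP.
Variables (R : realType) (S A : finType).
Variable (As : S -> {set A}).
Variable (Ptr : S -> A -> S -> R).

Definition admissible (b : {ffun S -> A}) : Prop := forall s, b s \in As s.

Definition chain (b : {ffun S -> A}) (s s' : S) : R := Ptr s (b s) s'.

Fixpoint npow (K : S -> S -> R) (n : nat) (s s' : S) : R :=
  match n with
  | O => (s == s')%:R
  | n'.+1 => \sum_(u : S) npow K n' s u * K u s'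
  end.

Definition irreducible (K : S -> S -> R) : Prop :=
  forall s s', exists n, 0 < npow K n s s'.

Definition aperiodic (K : S -> S -> R) : Prop :=
  forall s, forall d : nat, (2 <= d)%N ->
    ~ (forall n : nat, (1 <= n)%N -> 0 < npow K n s s -> (d %| n)%N).

Definition ergodic : Prop :=
  forall b, admissible b -> irreducible (chain b) /\ aperiodic (chain b).

Definition stationary (b : {ffun S -> A}) (pi : S -> R) : Prop :=
  (forall s, 0 <= pi s) /\ \sum_s pi s = 1 /\
  (forall s', pi s' = \sum_s pi s * chain b s s').

(* rho(beta, Theta) computed with the stationary distribution pi of beta *)
Definition rho (b : {ffun S -> A}) (pi : S -> R) (Th : S -> A -> R) : R :=
  \sum_s pi s * Th s (b s).

Definition LP_feasible (pi : S -> A -> R) : Prop :=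
  (forall s a, a \in As s -> 0 <= pi s a) /\
  \sum_s \sum_(a in As s) pi s a = 1 /\
  (forall s', \sum_(a in As s') pi s' a =
              \sum_s \sum_(a in As s) pi s a * Ptr s a s').

Definition LP_obj (Th : S -> A -> R) (pi : S -> A -> R) : R :=
  \sum_s \sum_(a in As s) pi s a * Th s a.

Definition LP_optimal (Th : S -> A -> R) (pi : S -> A -> R) : Prop :=
  LP_feasible pi /\ forall pi', LP_feasible pi' -> LP_obj Th pi' <= LP_obj Th pi.

End MDP.

Section Prob.
Local Open Scope ereal_scope.
Variables (R : realType) (d d' : measure_display)
  (Omega : measurableType d) (T : measurableType d').

Definition mutually_independent (P : probability Omega R) (X : nat -> Omega -> T) : Prop :=
  forall (I : seq nat) (B : nat -> set T), uniq I ->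
    (forall i, i \in I -> measurable (B i)) ->
    P (\big[setI/setT]_(i <- I) (X i @^-1` B i)) = \prod_(i <- I) P (X i @^-1` B i).

Definition identically_distributed (P : probability Omega R) (X : nat -> Omega -> T) : Prop :=
  forall n (B : set T), measurable B -> P (X n @^-1` B) = P (X 0%N @^-1` B).

Definition iid (P : probability Omega R) (X : nat -> Omega -> T) : Prop :=
  (forall n, measurable_fun setT (X n)) /\ mutually_independent P X /\
  identically_distributed P X.
End Prob.

Definition Theta_emp (R : realType) (S A : finType) (Omega T : Type)
  (f : S -> A -> T -> R) (X : nat -> Omega -> T) (n : nat) (w : Omega) : S -> A -> R :=
  fun s a => (n%:R)^-1 * \sum_(k < n) f s a (X k w).

Definition Zfirst (R : realType) (S A : finType) (Omega : Type)
  (beta : nat -> Omega -> {ffun S -> A}) (bstar : {ffun S -> A}) (w : Omega) : \bar R :=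
  ereal_inf [set (z%:R)%:E | z in
     [set z : nat | (1 <= z)%N /\ forall t : nat, (z <= t)%N -> beta t w = bstar]].

(* Main.v *)
Require Import Defs.
From HB Require Import structures.
From mathcomp Require Import all_boot all_order all_algebra.
From mathcomp Require Import all_classical all_reals all_analysis.
From mathcomp Require Import lebesgue_measure measurable_realfun.
From mathcomp Require Import finmap ring lra.
Import Order.TTheory GRing.Theory Num.Theory.
Local Open Scope ring_scope.
Local Open Scope classical_set_scope.

(* Deterministic part. Let [h] solve the Poisson equation of [bstar] for a reward
   matrix [Th] close to the mean matrix [M]. Deviating from [bstar] in the single
   state [s] with action [a] changes the average reward by [p s * adv s a], where [p]
   is the stationary distribution of the deviating policy; as [bstar] stays strictly
   optimal for [Th], every advantage off [bstar] is negative. The LP objective of a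
   feasible [q] equals the average reward of [bstar] plus [sum q * adv], so an LP
   optimum lives on [bstar], is stationary there, hence positive, and the greedy
   policy is [bstar]. So slot [n] fails only if the empirical mean of some entry is
   at distance more than a fixed [e] from its expectation.

   Probabilistic part. No measurability of the policies is needed: for each entry and
   sign, a Chernoff argument yields one integrable [W] exceeding every [n] at which
   the empirical mean is [e]-far from its expectation. Since [Z] is at most one plus
   the last failing slot, it is dominated by [1 + sum W]. *)

(** * Fredholm alternative for square matrices indexed by a finite type *)

Section FiniteLinearAlgebra.
Set Implicit Arguments.
Unset Strict Implicit.
Variables (F : fieldType) (S : finType) (K : S -> S -> F).

Let mxK : 'M[F]_#|S| := \matrix_(i, j) K (enum_val i) (enum_val j).

Lemma sum_enum_val (g : S -> F) : \sum_s g s = \sum_(i < #|S|) g (enum_val i).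
Proof. by rewrite (reindex (@enum_val S S))//; exact/onW_bij/enum_val_bij. Qed.

(** A square matrix killing a nonzero column is singular, so its determinant vanishes and it also
    kills a nonzero row. *)
Lemma left_kernel_nontrivial (h : S -> F) (s0 : S) : h s0 != 0 ->
  (forall s, \sum_s' K s s' * h s' = 0) ->
  exists2 u : S -> F, (exists s, u s != 0) &
    forall s', \sum_s u s * K s s' = 0.
Proof.
move=> h0 Kh.
have : ~~ (mxK \in unitmx).
  apply/negP => Ku; move/eqP: h0; apply.
  pose c : 'cV[F]_#|S| := \col_i h (enum_val i).
  have c0 : mxK *m c = 0.
    apply/matrixP => i j; rewrite !mxE -[RHS](Kh (enum_val i)).
    rewrite sum_enum_val.
    by apply: eq_bigr => k _; rewrite !mxE.
  have /matrixP/(_ (enum_rank s0) 0) : c = 0 by rewrite -(mulKmx Ku c) c0 mulmx0.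
  by rewrite !mxE enum_rankK.
rewrite unitmxE unitfE negbK => /eqP/eqP/det0P[v v0 vK].
exists (fun s => v 0 (enum_rank s)).
  have /rV0Pn[i vi] := v0.
  by exists (enum_val i); rewrite enum_valK.
move=> s'; have /matrixP/(_ 0 (enum_rank s')) := vK.
rewrite !mxE => vKs; rewrite -[RHS]vKs.
rewrite sum_enum_val.
by apply: eq_bigr => k _; rewrite !mxE enum_valK enum_rankK.
Qed.

Lemma right_solution :
  (forall u : S -> F, (forall s', \sum_s u s * K s s' = 0) -> forall s, u s = 0) ->
  forall r : S -> F, exists h : S -> F, forall s, \sum_s' K s s' * h s' = r s.
Proof.
move=> inj r.
have Ku : mxK \in unitmx.
  rewrite unitmxE unitfE; apply/negP => /det0P[v v0 vK].
  have /rV0Pn[i /eqP vi] := v0; apply: vi.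
  rewrite -(enum_valK i); apply: (inj (fun s => v 0 (enum_rank s))) => s'.
  have /matrixP/(_ 0 (enum_rank s')) := vK.
rewrite !mxE => vKs; rewrite -[RHS]vKs.
  rewrite sum_enum_val.
  by apply: eq_bigr => k _; rewrite !mxE enum_valK enum_rankK.
pose c : 'cV[F]_#|S| := \col_i r (enum_val i).
exists (fun s => (invmx mxK *m c) (enum_rank s) 0) => s.
have /matrixP/(_ (enum_rank s) 0) := mulKVmx Ku c; rewrite !mxE enum_rankK => rs; rewrite -[RHS]rs.
rewrite sum_enum_val.
by apply: eq_bigr => k _; rewrite [in RHS]mxE enum_valK enum_rankK.
Qed.

End FiniteLinearAlgebra.

(** * Invariant vectors of stochastic matrices *)

Section StochasticMatrix.
Set Implicit Arguments.
Unset Strict Implicit.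
Variables (R : realType) (S : finType) (K : S -> S -> R).
Hypothesis K_ge0 : forall s s', 0 <= K s s'.
Hypothesis K_sum1 : forall s, \sum_s' K s s' = 1.

Definition invariant_vec (u : S -> R) := forall s', u s' = \sum_s u s * K s s'.

Lemma sum_mul_stochastic (u : S -> R) : \sum_s' \sum_s u s * K s s' = \sum_s u s.
Proof.
rewrite exchange_big /=; apply: eq_bigr => s _.
by rewrite -mulr_sumr K_sum1 mulr1.
Qed.

(** The triangle inequality gives [|u| <= |u| K] entrywise. Both sides have the same total mass
    because [K] is stochastic, so the nonnegative differences sum to zero and all vanish. *)
Lemma invariant_vec_norm u : invariant_vec u -> invariant_vec (fun s => `|u s|).
Proof.
move=> uK.
have le s' : `|u s'| <= \sum_s `|u s| * K s s'.
  rewrite {1}uK (le_trans (ler_norm_sum _ _ _))//.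
  by apply: ler_sum => s _; rewrite normrM (ger0_norm (K_ge0 _ _)).
have : \sum_s' (\sum_s `|u s| * K s s' - `|u s'|) = 0.
  by rewrite sumrB sum_mul_stochastic subrr.
move/eqP; rewrite psumr_eq0; last by move=> s _; rewrite subr_ge0.
move=> /allP H s'; have := H s'; rewrite mem_index_enum => /(_ isT) /=.
by rewrite subr_eq0 => /eqP.
Qed.

Lemma invariant_vec_npow u n : invariant_vec u ->
  forall s', u s' = \sum_s u s * npow K n s s'.
Proof.
move=> uK; elim: n => [|n IH] s' /=.
  rewrite (bigD1 s')//= eqxx mulr1 big1 ?addr0// => s /negPf ->.
  by rewrite mulr0.
rewrite [LHS]uK; under [LHS]eq_bigr do rewrite IH mulr_suml.
rewrite exchange_big /=; apply: eq_bigr => s _.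
by rewrite mulr_sumr; apply: eq_bigr => v _; rewrite mulrA.
Qed.

Lemma npow_ge0 n s s' : 0 <= npow K n s s'.
Proof.
elim: n s' => [|n IH] s' /=; first exact: ler0n.
by apply: sumr_ge0 => v _; rewrite mulr_ge0.
Qed.

(** The constant vector lies in the right kernel of [I - K], so there is a nonzero left kernel
    vector [u]; then [|u|] is invariant too and can be normalised. The state [s0] witnesses that [S]
    is nonempty. *)
Lemma exists_stationary_vec (s0 : S) :
  exists u, [/\ forall s, 0 <= u s, \sum_s u s = 1 & invariant_vec u].
Proof.
have [||u [s us] uK] :=
    @left_kernel_nontrivial R S (fun s s' => (s == s')%:R - K s s') (fun=> 1) s0.
- exact: oner_neq0.
- move=> s; under eq_bigr do rewrite mulr1.
  rewrite sumrB K_sum1 (bigD1 s)//= eqxx big1 ?addr0 ?subrr// => t.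
  by rewrite eq_sym => /negPf ->.
have uinv : invariant_vec u.
  move=> s'; have /eqP := uK s'; under eq_bigr do rewrite mulrBr.
  rewrite sumrB subr_eq0 (bigD1 s')//= eqxx mulr1 big1 ?addr0; first by move/eqP.
  by move=> t /negPf ->; rewrite mulr0.
have T0 : 0 < \sum_s `|u s|.
  rewrite (bigD1 s)//= ltr_pwDl// ?normr_gt0//.
  exact: sumr_ge0.
exists (fun s => `|u s| / \sum_s `|u s|); split.
- by move=> t; rewrite divr_ge0// ltW.
- by rewrite -mulr_suml divff// gt_eqF.
- move=> s'; rewrite {1}(invariant_vec_norm uinv s') mulr_suml.
  by apply: eq_bigr => t _; rewrite mulrAC.
Qed.

Hypothesis K_irr : irreducible K.

(** Mass at [s0] reaches [s] along some power of [K] with a positive entry, and [u] is invariant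
    under that power. *)
Lemma invariant_vec_gt0 u : (forall s, 0 <= u s) -> invariant_vec u ->
  forall s0, 0 < u s0 -> forall s, 0 < u s.
Proof.
move=> u0 uK s0 us0 s; have [n Kn] := K_irr s0 s.
rewrite (invariant_vec_npow n uK s) (bigD1 s0)//= ltr_pwDl ?mulr_gt0//.
by apply: sumr_ge0 => t _; rewrite mulr_ge0 ?npow_ge0.
Qed.

(* [|u| + u] is invariant and nonnegative, so it vanishes identically as soon as
   it vanishes somewhere, i.e. as soon as [u] is nonpositive somewhere. *)
Lemma invariant_vec_sum0 u : invariant_vec u -> \sum_s u s = 0 ->
  forall s, u s = 0.
Proof.
move=> uK usum.
have nonneg0 (v : S -> R) : (forall s, 0 <= v s) -> \sum_s v s = 0 -> forall s, v s = 0.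
  move=> v0 /eqP; rewrite psumr_eq0// => /allP H s.
  by have := H s; rewrite mem_index_enum => /(_ isT)/eqP.
have D_inv : invariant_vec (fun s => `|u s| + u s).
  move=> s' /=; rewrite [X in X + _](invariant_vec_norm uK s') [X in _ + X]uK.
  by rewrite -big_split/=; apply: eq_bigr => s _; rewrite mulrDl.
have D_ge0 s : 0 <= `|u s| + u s by have := ler_norm (- u s); rewrite normrN; lra.
have [[s us]|/forallNP nus] := pselect (exists s, u s < 0).
  have H : forall s, `|u s| + u s = 0.
    apply: contrapT => /existsNP[t /eqP ut].
    have Dt : 0 < `|u t| + u t by rewrite lt_neqAle eq_sym ut D_ge0.
    have := invariant_vec_gt0 D_ge0 D_inv Dt s.
    by rewrite ltr0_norm//; lra.
  move=> t; apply/eqP; rewrite -oppr_eq0; apply/eqP; move: t.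
  apply: nonneg0; last by rewrite sumrN usum oppr0.
  by move=> t; have := H t; have := normr_ge0 (u t); lra.
apply: nonneg0 => // s; rewrite leNgt; apply/negP; exact: nus.
Qed.

End StochasticMatrix.

(** * The average-reward linear program and its stability near the mean rewards *)

Section LinearProgram.
Set Implicit Arguments.
Unset Strict Implicit.
Variables (R : realType) (S A : finType) (As : S -> {set A}).
Variable Ptr : S -> A -> S -> R.
Hypothesis Ptr_ge0 : forall s a s', a \in As s -> 0 <= Ptr s a s'.
Hypothesis Ptr_sum1 : forall s a, a \in As s -> \sum_s' Ptr s a s' = 1.
Hypothesis Ptr_ergodic : ergodic As Ptr.

Lemma stationary_gt0 b p : admissible As b -> stationary Ptr b p ->
  forall s, 0 < p s.
Proof.
move=> adm [p0 [p1 pK]].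
have [s0 ps0] : exists s0, 0 < p s0.
  apply: contrapT => /forallNP np.
  have : \sum_s p s = 0.
    apply: big1 => s _; apply/eqP; rewrite eq_le p0 andbT leNgt.
    exact/negP/np.
  by rewrite p1 => /eqP; rewrite oner_eq0.
have [irr _] := Ptr_ergodic adm.
apply: (invariant_vec_gt0 (K := chain Ptr b)) ps0 => //.
by move=> s s'; exact: Ptr_ge0.
Qed.

Lemma exists_stationary b (s0 : S) : admissible As b ->
  exists p, stationary Ptr b p.
Proof.
move=> adm; have [||p [p0 p1 pK]] := @exists_stationary_vec R S (chain Ptr b) _ _ s0.
- by move=> s s'; exact: Ptr_ge0.
- by move=> s; exact: Ptr_sum1.
by exists p.
Qed.

(* Fredholm's alternative applied to [I - K + 1 p] ([L] below), which is injective
   although [I - K] is not; applying [p] to the solution identifies the constant. *)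
Lemma poisson_equation b p (Th : S -> A -> R) :
  admissible As b -> stationary Ptr b p ->
  exists h : S -> R, forall s,
    Th s (b s) + \sum_s' Ptr s (b s) s' * h s' = h s + rho b p Th.
Proof.
move=> adm st; have [p0 [p1 pK]] := st.
have K0 s s' : 0 <= chain Ptr b s s' by exact: Ptr_ge0.
have K1 s : \sum_s' chain Ptr b s s' = 1 by exact: Ptr_sum1.
have [irr _] := Ptr_ergodic adm.
pose L s s' := (s == s')%:R - chain Ptr b s s' + p s'.
have rowL (u : S -> R) s' :
    \sum_s u s * L s s' = u s' - \sum_s u s * chain Ptr b s s' + (\sum_s u s) * p s'.
  rewrite /L; under eq_bigr do rewrite mulrDr mulrBr.
  rewrite big_split/= sumrB -mulr_suml; congr (_ - _ + _).
  rewrite (bigD1 s')//= eqxx mulr1 big1 ?addr0// => t /negPf ->.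
  by rewrite mulr0.
have inj (u : S -> R) : (forall s', \sum_s u s * L s s' = 0) -> forall s, u s = 0.
  move=> uL; have us : \sum_s u s = 0.
    have : \sum_s' \sum_s u s * L s s' = 0 by exact: big1.
    under eq_bigr do rewrite rowL.
    by rewrite big_split/= sumrB sum_mul_stochastic// subrr add0r -mulr_sumr p1 mulr1.
  apply: (invariant_vec_sum0 K0 K1 irr) => // s'.
  by have := uL s'; rewrite rowL us mul0r addr0 => /eqP; rewrite subr_eq0 => /eqP.
have [h hL] := right_solution inj (fun s => Th s (b s)).
have rL s : \sum_s' L s s' * h s' =
    h s - \sum_s' Ptr s (b s) s' * h s' + \sum_s' p s' * h s'.
  rewrite /L; under eq_bigr do rewrite mulrDl mulrBl.
  rewrite big_split/= sumrB; congr (_ - _ + _).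
  rewrite (bigD1 s)//= eqxx mul1r big1 ?addr0// => t.
  by rewrite eq_sym => /negPf ->; rewrite mul0r.
exists h => s; rewrite -(hL s) rL.
suff -> : rho b p Th = \sum_s' p s' * h s' by ring.
rewrite /rho; under eq_bigr do rewrite -hL mulr_sumr.
rewrite exchange_big/=; apply: eq_bigr => s' _.
under eq_bigr do rewrite mulrA.
by rewrite -mulr_suml rowL p1 mul1r -pK subrr add0r.
Qed.

(** The state-action occupation measure of [b], through which policies compete in the LP. *)
Definition policy_lp (b : {ffun S -> A}) (p : S -> R) (s : S) (a : A) : R :=
  if a == b s then p s else 0.

Lemma sum_policy_lp b p (g : A -> R) s : admissible As b ->
  \sum_(a in As s) policy_lp b p s a * g a = p s * g (b s).
Proof.
move=> adm; rewrite (bigD1 (b s))//= /policy_lp eqxx big1 ?addr0//.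
by move=> a /andP[_ /negPf ->]; rewrite mul0r.
Qed.

Lemma policy_lp_feasible b p : admissible As b -> stationary Ptr b p ->
  LP_feasible As Ptr (policy_lp b p).
Proof.
move=> adm [p0 [p1 pK]].
have sumE s : \sum_(a in As s) policy_lp b p s a = p s.
  by have := sum_policy_lp p (fun=> 1) s adm; under eq_bigr do rewrite mulr1; rewrite mulr1.
split; [|split].
- by move=> s a _; rewrite /policy_lp; case: ifP.
- by under eq_bigr do rewrite sumE.
- move=> s'; rewrite sumE pK; apply: eq_bigr => s _.
  by rewrite (sum_policy_lp p (fun a => Ptr s a s')).
Qed.

Lemma policy_lp_obj b p Th : admissible As b ->
  LP_obj As Th (policy_lp b p) = rho b p Th.
Proof. by move=> adm; apply: eq_bigr => s _; rewrite sum_policy_lp. Qed.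

(** The Bellman residual for bias [h] and gain [c]. *)
Definition advantage (Th : S -> A -> R) (h : S -> R) (c : R) s a : R :=
  Th s a + \sum_s' Ptr s a s' * h s' - h s - c.

(** The balance constraints on [q] cancel the two terms in [h], and total mass one turns the
    constant into [c]. *)
Lemma LP_obj_advantage Th h c q : LP_feasible As Ptr q ->
  LP_obj As (advantage Th h c) q = LP_obj As Th q - c.
Proof.
move=> [_ [q1 qK]]; rewrite /LP_obj /advantage.
have -> : \sum_s \sum_(a in As s)
      q s a * (Th s a + \sum_s' Ptr s a s' * h s' - h s - c) =
    \sum_s \sum_(a in As s) q s a * Th s a
    + \sum_s \sum_(a in As s) q s a * (\sum_s' Ptr s a s' * h s')
    - \sum_s \sum_(a in As s) q s a * h s
    - \sum_s \sum_(a in As s) q s a * c.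
  rewrite -big_split/= -!sumrB; apply: eq_bigr => s _.
  rewrite -big_split/= -!sumrB; apply: eq_bigr => a _; ring.
under [X in _ - X]eq_bigr do rewrite -mulr_suml.
rewrite -mulr_suml q1 mul1r; congr (_ - _).
rewrite -addrA -[RHS]addr0; congr (_ + _); apply/eqP; rewrite subr_eq0; apply/eqP.
under [RHS]eq_bigr do rewrite -mulr_suml qK mulr_suml.
under [LHS]eq_bigr do under eq_bigr do rewrite mulr_sumr.
under [LHS]eq_bigr do rewrite exchange_big/=.
rewrite exchange_big/=; apply: eq_bigr => s' _.
apply: eq_bigr => s _; rewrite mulr_suml; apply: eq_bigr => a _.
by rewrite mulrA.
Qed.

(* If a policy beats its single-state deviations, its advantage is negative off
   the policy, so complementary slackness puts every LP optimum on the policy. *)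
Lemma LP_optimal_support (Th : S -> A -> R) bstar
    (p : {ffun S -> A} -> S -> R) q :
  admissible As bstar ->
  (forall b, admissible As b -> stationary Ptr b (p b)) ->
  (forall b, admissible As b -> b != bstar ->
    rho b (p b) Th < rho bstar (p bstar) Th) ->
  LP_optimal As Ptr Th q ->
  forall s, 0 < q s (bstar s) /\
    forall a, a \in As s -> a != bstar s -> q s a = 0.
Proof.
move=> adm st opt [qF qO].
have [h hE] := poisson_equation Th adm (st _ adm).
set c := rho bstar (p bstar) Th in opt hE *.
pose adv := advantage Th h c.
have adv0 s : adv s (bstar s) = 0 by rewrite /adv /advantage hE; ring.
have adv_lt0 s a : a \in As s -> a != bstar s -> adv s a < 0.
  move=> aA ab; pose b : {ffun S -> A} := [ffun t => if t == s then a else bstar t].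
  have admb : admissible As b by move=> t; rewrite ffunE; case: eqP => [->|].
  have bb : b != bstar.
    by apply: contra ab => /eqP/ffunP/(_ s); rewrite ffunE eqxx => ->.
  have := opt b admb bb; rewrite -subr_lt0 -(policy_lp_obj _ _ admb).
  rewrite -(LP_obj_advantage _ h _ (policy_lp_feasible admb (st _ admb))).
  rewrite policy_lp_obj// /rho (bigD1 s)//= [b s]ffunE eqxx.
  rewrite big1 ?addr0; last first.
    by move=> t /negPf ts; rewrite ffunE ts -/(adv t _) adv0 mulr0.
  have [p0 _] := st _ admb.
  (* What remains is [p b s * adv s a < 0] with [p b s >= 0], which forces the sign of the
     advantage. *)
  by rewrite -/(adv s a); have := p0 s; nra.
have qadv0 s a : a \in As s -> 0 <= - (q s a * adv s a).
  move=> aA; rewrite oppr_ge0; have [q0 _] := qF; have qa := q0 s a aA.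
  have [->|ab] := eqVneq a (bstar s); first by rewrite adv0 mulr0.
  by rewrite mulr_ge0_le0// ltW// adv_lt0.
have qadv s a : a \in As s -> q s a * adv s a = 0.
  (* Complementary slackness: the terms are nonnegative, and their sum is [c] minus the optimal
     value, hence nonpositive since [bstar] is a competitor. *)
  move=> aA; have sum0 : \sum_t \sum_(a' in As t) - (q t a' * adv t a') = 0.
    apply/eqP; rewrite eq_le; apply/andP; split; last first.
      by apply: sumr_ge0 => t _; apply: sumr_ge0 => a'; exact: qadv0.
    under eq_bigr do rewrite sumrN.
    rewrite sumrN oppr_le0 -/(LP_obj As adv q) LP_obj_advantage// subr_ge0.
    rewrite /c -(policy_lp_obj _ _ adm); apply: qO.
    exact: policy_lp_feasible (st _ adm).
  move/eqP: sum0; rewrite psumr_eq0; last first.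
    by move=> t _; apply: sumr_ge0 => a'; exact: qadv0.
  move=> /allP/(_ s); rewrite mem_index_enum => /(_ isT)/=.
  rewrite psumr_eq0; last by move=> a'; exact: qadv0.
  move=> /allP/(_ a); rewrite mem_index_enum aA => /(_ isT)/=.
  by rewrite oppr_eq0 => /eqP.
have q0 s a : a \in As s -> a != bstar s -> q s a = 0.
  move=> aA ab; have /eqP := qadv s a aA; rewrite mulf_eq0 => /orP[/eqP//|].
  by rewrite lt_eqF// adv_lt0.
move=> s; split; last exact: q0.
have sumq t g : \sum_(a in As t) q t a * g a = q t (bstar t) * g (bstar t) :> R.
  rewrite (bigD1 (bstar t))//= big1 ?addr0// => a /andP[aA ab].
  by rewrite q0// mul0r.
have sumq1 t : \sum_(a in As t) q t a = q t (bstar t).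
  by have := sumq t (fun=> 1); under eq_bigr do rewrite mulr1; rewrite mulr1.
have [qge [q1 qK]] := qF.
apply: (@stationary_gt0 bstar (fun t => q t (bstar t)) adm); split; [|split].
- by move=> t; exact: qge.
- by rewrite -q1; apply: eq_bigr => t _; rewrite sumq1.
- move=> s'; rewrite -sumq1 qK; apply: eq_bigr => t _.
  by rewrite (sumq t (fun a => Ptr t a s')).
Qed.

Lemma rho_perturb b p (Th Th' : S -> A -> R) e : stationary Ptr b p ->
  (forall s a, `|Th s a - Th' s a| <= e) -> `|rho b p Th - rho b p Th'| <= e.
Proof.
move=> [p0 [p1 _]] close; rewrite /rho -sumrB.
rewrite (le_trans (ler_norm_sum _ _ _))//.
rewrite -[leRHS]mul1r -p1 mulr_suml; apply: ler_sum => s _.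
by rewrite -mulrBr normrM ger0_norm// ler_wpM2l.
Qed.

Lemma finite_positive_lower_bound (I : finType) (Q : pred I) (g : I -> R) :
  (forall i, Q i -> 0 < g i) ->
  exists2 e : R, 0 < e & forall i, Q i -> e <= g i.
Proof.
(* The default [1] keeps the minimum positive when no index satisfies [Q]. *)
move=> g0; exists (\big[Order.min/1]_(i | Q i) g i).
  by apply/bigmin_gtP; split.
by move=> i Qi; exact: bigmin_le_cond.
Qed.

Lemma greedy_optimal_near (M : S -> A -> R) bstar :
  admissible As bstar ->
  (forall b, admissible As b -> b != bstar ->
     forall pib pis, stationary Ptr b pib -> stationary Ptr bstar pis ->
       rho b pib M < rho bstar pis M) ->
  exists2 e : R, 0 < e & forall Th q (b : {ffun S -> A}),
    (forall s a, `|Th s a - M s a| <= e) ->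
    LP_optimal As Ptr Th q ->
    (forall s, b s \in As s /\ forall a, a \in As s -> q s a <= q s (b s)) ->
    b = bstar.
Proof.
move=> adm opt.
(* Without states all policies coincide and any [e] works. *)
have [S0|s0] := pickP (fun _ : S => true); last first.
  by exists 1 => // Th q b _ _ _; apply/ffunP => s; have := s0 s.
have /choice[p st] : forall b : {ffun S -> A}, exists p : S -> R,
    admissible As b -> stationary Ptr b p.
  move=> b.
  have [/(exists_stationary S0)[p ?]|nadm] := pselect (admissible As b).
    by exists p.
  by exists (fun=> 0).
pose Q (b : {ffun S -> A}) := `[<admissible As b>] && (b != bstar).
have [b|e e0 eP] := @finite_positive_lower_bound _ Q
    (fun b => rho bstar (p bstar) M - rho b (p b) M).
  by move=> /andP[/asboolP admb bb]; rewrite subr_gt0; apply: opt => //; exact: st.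
(* Each of the two compared average rewards moves by at most [e / 3], so a gap of at least [e] stays
   positive. *)
exists (e / 3); first by rewrite divr_gt0.
move=> Th q b close qopt greedy.
have /(LP_optimal_support adm st) : forall b, admissible As b -> b != bstar ->
    rho b (p b) Th < rho bstar (p bstar) Th.
  move=> b' admb bb; have := eP b'; rewrite /Q bb andbT asboolT// => /(_ isT).
  have := rho_perturb (st _ admb) close; have := rho_perturb (st _ adm) close.
  by rewrite !ler_norml => /andP[? ?] /andP[? ?]; lra.
move=> /(_ _ qopt) sup; apply/ffunP => s; have [bA bmax] := greedy s.
have [qs q0] := sup s; apply/eqP/negPn/negP => bs.
(* An action off [bstar] has LP mass zero, below the positive mass of [bstar s], so it is no
   argmax. *)
by have := bmax (bstar s) (adm s); rewrite (q0 _ bA bs); lra.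
Qed.

End LinearProgram.

(** * Expectations of products of independent variables *)

Section IndependentProducts.
Set Implicit Arguments.
Unset Strict Implicit.
Context {R : realType} {d d' : measure_display}.
Context {Omega : measurableType d} {T : measurableType d'}.
Variable P : probability Omega R.
Import HBNNSimple.

Lemma integral_indic_comp (Y : Omega -> T) (B : set T) :
  measurable_fun setT Y -> measurable B ->
  (\int[P]_w (\1_B (Y w))%:E = P (Y @^-1` B))%E.
Proof.
move=> mY mB; rewrite (_ : (fun w => _) = EFin \o \1_(Y @^-1` B)); last first.
  by apply/funext => w /=; rewrite !indicE.
rewrite integral_indic ?setIT// -[X in measurable X]setTI.
exact: mY.
Qed.

Section OneFactor.
Variables (Y Y' : Omega -> T) (phi : Omega -> R) (c : R).
Hypothesis mY : measurable_fun setT Y.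
Hypothesis mY' : measurable_fun setT Y'.
Hypothesis mphi : measurable_fun setT phi.
Hypothesis phi0 : forall w, 0 <= phi w.
Hypothesis factor_indic : forall B, measurable B ->
  (\int[P]_w (phi w * \1_B (Y w))%:E = c%:E * P (Y' @^-1` B))%E.

Lemma factor_nnsfun (g : {nnsfun T >-> R}) :
  (\int[P]_w (phi w * g (Y w))%:E = c%:E * \int[P]_w (g (Y' w))%:E)%E.
Proof.
set s : seq R := fset_set (range g).
(* Values of [g] are nonnegative, so [|r|] equals [r] on the range; writing it this way makes every
   summand visibly nonnegative. *)
have gE y : g y = \sum_(r <- s) `|r| * \1_(g @^-1` [set r]) y.
  rewrite [LHS]fimfunE fsbig_finite//=; apply: eq_big_seq => r.
  by rewrite in_fset_set// => /set_mem[x _ <-]; rewrite ger0_norm.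
have mB r : measurable (g @^-1` [set r]) by [].
have mind r (V : Omega -> T) : measurable_fun setT V ->
    measurable_fun setT (fun w => \1_(g @^-1` [set r]) (V w) : R).
  by move=> mV; apply: measurableT_comp mV; exact: measurable_indic.
under eq_integral do rewrite gE mulr_sumr -sumEFin.
under [in RHS]eq_integral do rewrite gE -sumEFin.
rewrite ge0_integral_sum//; last 2 first.
- move=> r; apply/measurable_EFinP; apply: measurable_funM => //.
  apply: measurable_funM => //; auto.
- by move=> r w _; rewrite lee_fin !mulr_ge0.
rewrite ge0_integral_sum//; last first.
  by move=> r; apply/measurable_EFinP; apply: measurable_funM => //; auto.
rewrite ge0_sume_distrr; last first.
  by move=> r _; apply: integral_ge0 => w _; rewrite lee_fin mulr_ge0.
apply: eq_bigr => r _.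
under eq_integral do rewrite mulrCA EFinM.
rewrite ge0_integralZl_EFin//; last 2 first.
- by move=> w _; rewrite lee_fin mulr_ge0.
- by apply/measurable_EFinP; apply: measurable_funM => //; auto.
rewrite factor_indic//.
under [in RHS]eq_integral do rewrite EFinM.
rewrite ge0_integralZl_EFin//; last first.
  by apply/measurable_EFinP; auto.
by rewrite (integral_indic_comp (B := g @^-1` [set r]))// muleCA.
Qed.

(** Monotone convergence along simple functions. Keeping [Y] and [Y'] apart serves two uses:
    [Y' = Y] splits off an independent factor, and [phi = 1] transfers expectations between equally
    distributed variables. *)
Lemma factor_ge0 (g : T -> R) : measurable_fun setT g -> (forall y, 0 <= g y) ->
  (\int[P]_w (phi w * g (Y w))%:E = c%:E * \int[P]_w (g (Y' w))%:E)%E.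
Proof.
move=> mg g0.
have mEg : measurable_fun setT (EFin \o g) by exact/measurable_EFinP.
pose g_ := nnsfun_approx measurableT mEg.
have mg_ n (V : Omega -> T) : measurable_fun setT V -> measurable_fun setT (fun w => g_ n (V w)).
  by move=> mV; apply: measurableT_comp mV.
have g_cvg y : (g_ n y)%:E @[n --> \oo] --> (g y)%:E.
  by apply: (@cvg_nnsfun_approx _ _ _ _ measurableT _ mEg) => // x _; rewrite lee_fin.
have g_nd y m n : (m <= n)%N -> g_ m y <= g_ n y.
  by move=> mn; exact/lefP/nd_nnsfun_approx.
have cvgL : (\int[P]_w (phi w * g_ n (Y w))%:E @[n --> \oo] -->
             \int[P]_w (phi w * g (Y w))%:E)%E.
  have -> : (\int[P]_w (phi w * g (Y w))%:E =
      \int[P]_w (limn (fun n => (phi w * g_ n (Y w))%:E)))%E.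
    apply: eq_integral => w _; apply/esym/cvg_lim => //.
    under eq_fun do rewrite EFinM.
    by rewrite EFinM; apply: cvgeZl => //; exact: g_cvg.
  apply: cvg_monotone_convergence => //.
  - by move=> n; apply/measurable_EFinP; apply: measurable_funM => //; auto.
  - by move=> n w _; rewrite lee_fin mulr_ge0.
  - by move=> w _ m n mn; rewrite lee_fin ler_wpM2l// g_nd.
have cvgR : (c%:E * \int[P]_w (g_ n (Y' w))%:E @[n --> \oo] -->
             c%:E * \int[P]_w (g (Y' w))%:E)%E.
  apply: cvgeZl => //.
  have -> : (\int[P]_w (g (Y' w))%:E = \int[P]_w (limn (fun n => (g_ n (Y' w))%:E)))%E.
    by apply: eq_integral => w _; apply/esym/cvg_lim => //; exact: g_cvg.
  apply: cvg_monotone_convergence => //.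
  - by move=> n; apply/measurable_EFinP; auto.
  - by move=> n w _; rewrite lee_fin.
  - by move=> w _ m n mn; rewrite lee_fin g_nd.
apply: cvg_unique cvgL _; rewrite //.
rewrite (_ : (fun n => _) = (fun n => c%:E * \int[P]_w (g_ n (Y' w))%:E)%E)//.
by apply/funext => n; exact: factor_nnsfun.
Qed.

End OneFactor.

Variable X : nat -> Omega -> T.
Hypothesis mX : forall k, measurable_fun setT (X k).
Hypothesis indX : mutually_independent P X.

(* The factors are turned from indicators into general functions one at a time. *)
Lemma integral_prod_indep (N : nat) (h : nat -> T -> R) (e : nat -> R) :
  (forall k, measurable_fun setT (h k)) -> (forall k y, 0 <= h k y) ->
  (forall k, \int[P]_w (h k (X k w))%:E = (e k)%:E)%E ->
  (\int[P]_w (\prod_(k < N) h k (X k w))%:E = (\prod_(k < N) e k)%:E)%E.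
Proof.
(* Induction on the number [n] of arbitrary leading factors, the others being indicators: [n = 0] is
   independence itself, [n = N] the claim. *)
suff H n : (n <= N)%N -> forall (h : nat -> T -> R) (e : nat -> R),
    (forall k, measurable_fun setT (h k)) -> (forall k y, 0 <= h k y) ->
    (forall k, \int[P]_w (h k (X k w))%:E = (e k)%:E)%E ->
    (forall k, (n <= k < N)%N -> exists2 B, measurable B & h k = \1_B) ->
    (\int[P]_w (\prod_(k < N) h k (X k w))%:E = (\prod_(k < N) e k)%:E)%E.
  move=> mh h0 he; apply: (H N) => // k.
  by case: ltnP => //; rewrite andbF.
elim: n => [_|n IH nN] {}h {}e mh h0 he hB.
  have /choice[B BP] : forall k, exists B, measurable B /\ ((k < N)%N -> h k = \1_B).
    move=> k; have [kN|kN] := ltnP k N; last by exists setT; split => //; rewrite ltnNge kN.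
    by have [|B mB ?] := hB k; [rewrite kN|exists B].
  have PB k : (k < N)%N -> P (X k @^-1` B k) = (e k)%:E.
    by move=> kN; rewrite -he (BP k).2// integral_indic_comp//; exact: (BP k).1.
  have := indX (iota_uniq 0 N) (fun i _ => (BP i).1).
  have -> : iota 0 N = index_iota 0 N by rewrite /index_iota subn0.
  rewrite !big_mkord => indB.
  rewrite -prodEFin (eq_bigr (fun i : 'I_N => P (X i @^-1` B i))); last first.
    by move=> i _; rewrite PB.
  rewrite -indB.
  rewrite -[in RHS](setIT (\big[_/_]_(_ < _) _)) -integral_indic//; last first.
    apply: bigsetI_measurable => i _; rewrite -[X in measurable X]setTI.
    by apply: mX => //; exact: (BP i).1.
  apply: eq_integral => w _; congr EFin.
  rewrite (big_morph (fun A : set Omega => \1_A w) (id1 := 1) (op1 := *%R)).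
  - by apply: eq_bigr => i _; rewrite (BP i).2.
  - by move=> A1 A2; rewrite indicI.
  - by rewrite indicT.
pose c := \prod_(k < N | k != Ordinal nN) e k.
have -> : (\prod_(k < N) e k)%:E = (c%:E * \int[P]_w (h n (X n w))%:E)%E.
  by rewrite (bigD1 (Ordinal nN))//= he -EFinM mulrC.
under eq_integral do rewrite (bigD1 (Ordinal nN))//= mulrC.
apply: factor_ge0 => //.
- under eq_fun do rewrite big_mkcond/=.
  apply: measurable_prod => k _; case: (k != _) => //; exact: measurableT_comp.
- by move=> w; exact: prodr_ge0.
move=> B mB.
(* With factor [n] replaced by an indicator, the induction hypothesis applies. *)
pose h' k := if k == n then \1_B else h k.
pose e' k := if k == n then fine (P (X n @^-1` B)) else e k.
have h'E k : k != Ordinal nN -> h' k = h k.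
  by rewrite -val_eqE /h' => /negPf ->.
have e'E k : k != Ordinal nN -> e' k = e k.
  by rewrite -val_eqE /e' => /negPf ->.
have h'n : h' n = \1_B by rewrite /h' eqxx.
have e'n : e' n = fine (P (X n @^-1` B)) by rewrite /e' eqxx.
have mXB : measurable (X n @^-1` B) by rewrite -[X in measurable X]setTI; exact: mX.
have := IH (ltnW nN) h' e' _ _ _ _.
under eq_integral => w _.
  rewrite (bigD1 (Ordinal nN))//= mulrC h'n.
  under eq_bigr => k kn do rewrite h'E//.
  over.
rewrite (bigD1 (Ordinal nN))//= mulrC e'n (eq_bigr (fun i : 'I_N => e i)); last first.
  by move=> k kn; rewrite e'E.
rewrite EFinM fineK ?fin_num_measure//; apply.
- by move=> k; rewrite /h'; case: eqP => // _; exact: measurable_indic.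
- by move=> k y; rewrite /h'; case: eqP => // _; rewrite indicE.
- move=> k; rewrite /h' /e'; case: eqP => [->|_]; last exact: he.
  by rewrite integral_indic_comp// fineK// fin_num_measure.
- move=> k /andP[nk kN]; rewrite /h'; case: eqP => [_|/eqP kn]; first by exists B.
  by apply: hB; rewrite kN ltn_neqAle eq_sym kn nk.
Qed.

Lemma integral_id_distributed (h : T -> R) k :
  identically_distributed P X ->
  measurable_fun setT h -> (forall y, 0 <= h y) ->
  (\int[P]_w (h (X k w))%:E = \int[P]_w (h (X 0%N w))%:E)%E.
Proof.
move=> idX mh h0; rewrite -[RHS]mul1e.
under eq_integral do rewrite -[h _]mul1r.
apply: (@factor_ge0 _ _ (fun=> 1)) => // B mB.
under eq_integral do rewrite mul1r.
by rewrite mul1e integral_indic_comp// idX.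
Qed.

(** * Exponential moments and the Chernoff argument *)

Lemma expR_le_quadratic (x : R) : x <= 1 / 2 -> expR x <= 1 + x + 2 * x ^+ 2.
Proof.
move=> x12; have x1 : 0 < 1 - x by lra.
(* After multiplication by [1 - x], the left side is at most [exp x * exp (- x) = 1], and the right
   side is [1 + x ^ 2 (1 - 2 x) >= 1]. *)
rewrite -(ler_pM2r x1); apply: (@le_trans _ _ 1).
  rewrite -[leRHS](expRxMexpNx_1 x) ler_pM2l ?expR_gt0//.
  by have := expR_ge1Dx (- x).
have -> : (1 + x + 2 * x ^+ 2) * (1 - x) = 1 + x ^+ 2 * (1 - 2 * x) by ring.
by rewrite lerDl mulr_ge0// ?sqr_ge0//; lra.
Qed.

Lemma integral_probability_cst (k : R) : (\int[P]_w k%:E = k%:E)%E.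
Proof.
rewrite integral_cst//; have PT := probability_setT P.
by rewrite [X in (_ * X)%E]PT mule1.
Qed.

Lemma bounded_integrable (y : Omega -> R) (c : R) :
  measurable_fun setT y -> (forall w, `|y w| <= c) ->
  P.-integrable setT (EFin \o y).
Proof.
move=> my yc; apply: measurable_bounded_integrable => //.
  by rewrite ltey_eq fin_num_measure.
exists c; split; first exact: num_real.
by move=> x cx w _ /=; rewrite (le_trans (yc w))// ltW.
Qed.

(** The quadratic bound gives an expectation of at most [1 - l m + 2 (l c) ^ 2], which is below one
    for small [l]. *)
Lemma exp_moment_lt1 (y : Omega -> R) (c m : R) :
  measurable_fun setT y -> (forall w, `|y w| <= c) -> 0 < c -> 0 < m ->
  (\int[P]_w (y w)%:E = (- m)%:E)%E ->
  exists l q, [/\ 0 < l, 0 <= q, q < 1 &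
    (\int[P]_w (expR (l * y w))%:E = q%:E)%E].
Proof.
move=> my yc c0 m0 Ey.
have D0 : 0 < 4 * c ^+ 2 + 2 * c * m by rewrite addr_gt0 ?mulr_gt0 ?exprn_gt0.
(* The term [2 c m] ensures [l c <= 1 / 2], and [4 c ^ 2] ensures [2 l c ^ 2 < m]. *)
pose l := m / (4 * c ^+ 2 + 2 * c * m).
have l0 : 0 < l by rewrite divr_gt0.
have lD : l * (4 * c ^+ 2 + 2 * c * m) = m by rewrite /l divfK ?gt_eqF.
have lc0 : 0 < l * c by exact: mulr_gt0.
have lc : l * c <= 1 / 2.
  rewrite -(ler_pM2r m0); have := lD; nra.
have ly w : `|l * y w| <= l * c by rewrite normrM gtr0_norm// ler_wpM2l// ltW.
have mly : measurable_fun setT (fun w => l * y w) by exact: measurable_funM.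
have mexp : measurable_fun setT (fun w => expR (l * y w)).
  exact: measurableT_comp.
have iexp : P.-integrable setT (EFin \o (fun w => expR (l * y w))).
  apply: (bounded_integrable (c := expR (l * c))) => // w.
  by rewrite ger0_norm ?expR_ge0// ler_expR (le_trans (ler_norm _)).
have iy := bounded_integrable my yc.
pose k := 1 + 2 * (l * c) ^+ 2.
have bound w : expR (l * y w) <= k + l * y w.
  have := ly w; rewrite ler_norml => /andP[lo hi].
  have -> : k + l * y w = 1 + l * y w + 2 * (l * c) ^+ 2 by rewrite /k; ring.
  rewrite (le_trans (expR_le_quadratic _))//; first exact: le_trans lc.
  by rewrite lerD2l ler_pM2l//; nra.
have E : (\int[P]_w (expR (l * y w))%:E <= (k - l * m)%:E)%E.
  have -> : ((k - l * m)%:E = \int[P]_w (k + l * y w)%:E)%E.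
    under eq_integral do rewrite EFinD EFinM.
    rewrite integralD//=; last 2 first.
    - exact: finite_measure_integrable_cst.
    - exact: integrableZl.
    rewrite integral_probability_cst integralZl// Ey.
    by rewrite -EFinM -EFinD mulrN.
  apply: le_integral => //; last by move=> w _; rewrite lee_fin.
  apply: (bounded_integrable (c := `|k| + l * c)).
    exact: measurable_funD.
  by move=> w; rewrite (le_trans (ler_normD _ _))// lerD2l.
have fin := integrable_fin_num measurableT iexp.
exists l, (fine (\int[P]_w (expR (l * y w))%:E)); split => //.
- by rewrite fine_ge0// integral_ge0// => w _; rewrite lee_fin expR_ge0.
- rewrite -lte_fin fineK// (le_lt_trans E)// lte_fin /k.
  have : l * m * (4 * c ^+ 2 + 2 * c * m) = m ^+ 2 by rewrite mulrAC lD; ring.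
  have -> : (l * c) ^+ 2 = l * c * (l * c) by rewrite expr2.
  suff : 2 * (l * c ^+ 2) < m by nra.
  by have := lD; have := mulr_gt0 l0 (mulr_gt0 c0 m0); have := mulr_gt0 l0 (mulr_gt0 c0 c0); nra.
- by rewrite fineK.
Qed.

Lemma geometric_nneseries_lty (C q : R) : 0 <= C -> 0 <= q -> q < 1 ->
  (\sum_(n <oo) (C * q ^+ n)%:E < +oo)%E.
Proof.
move=> C0 q0 q1; apply: (@le_lt_trans _ _ (C / (1 - q))%:E); last exact: ltry.
apply: lime_le.
  by apply: is_cvg_nneseries => n _ _; rewrite lee_fin mulr_ge0// exprn_ge0.
apply: nearW => n; rewrite sumEFin lee_fin.
have := @geometric_seriesE _ C q; rewrite lt_eqF// => /(_ isT)/funeqP/(_ n).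
rewrite /series/= => ->; rewrite ler_wpM2r ?invr_ge0 ?subr_ge0 ?(ltW q1)//.
by rewrite ler_piMr// gerBl exprn_ge0.
Qed.

(* With [y := g + m / 2], of mean [- m / 2], an exceptional [n] satisfies
   [n l m / 2 <= exp (l n m / 2) <= prod_(k < n) exp (l y(X_k))], and the product has
   expectation [q ^ n] with [q < 1]; [W] sums these products over all [n]. *)
Lemma exceptional_times_dominated (g : T -> R) (c m : R) :
  identically_distributed P X ->
  measurable_fun setT g -> (forall x, `|g x| <= c) -> 0 < c -> 0 < m ->
  (\int[P]_w (g (X 0%N w))%:E = (- m)%:E)%E ->
  exists W : Omega -> \bar R, [/\ measurable_fun setT W,
    forall w, (0 <= W w)%E, (\int[P]_w W w < +oo)%E &
    forall w n, 0 <= \sum_(k < n) g (X k w) -> (n%:R%:E <= W w)%E].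
Proof.
move=> idX mg gc c0 m0 Eg.
pose y x := g x + m / 2.
have my : measurable_fun setT y by exact: measurable_funD.
have yc x : `|y x| <= c + m / 2.
  by rewrite (le_trans (ler_normD _ _))// lerD// ger0_norm// divr_ge0// ltW.
have mgX : measurable_fun setT (g \o X 0%N) by exact: measurableT_comp.
have Ey : (\int[P]_w (y (X 0%N w))%:E = (- (m / 2))%:E)%E.
  under eq_integral do rewrite EFinD.
  rewrite integralD//=; last 2 first.
  - by apply: (bounded_integrable (c := c)).
  - exact: finite_measure_integrable_cst.
  rewrite Eg integral_probability_cst -EFinD.
  by congr EFin; field.
have [||||l [q [l0 q0 q1 Eq]]] :=
  @exp_moment_lt1 (y \o X 0%N) (c + m / 2) (m / 2) _ _ _ _ Ey.
- exact: measurableT_comp.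
- by move=> w; exact: yc.
- by rewrite addr_gt0// divr_gt0.
- by rewrite divr_gt0.
pose h x := expR (l * y x).
have mh : measurable_fun setT h by apply: measurableT_comp => //; exact: measurable_funM.
have h0 x : 0 <= h x by exact: expR_ge0.
(* Scaled so that [C * (l * (n m / 2)) = n]. *)
pose C := (l * (m / 2))^-1.
have C0 : 0 < C by rewrite invr_gt0 mulr_gt0// divr_gt0.
pose W_ n w := (C * \prod_(k < n) h (X k w))%:E.
have W0 n w : (0 <= W_ n w)%E.
  by rewrite lee_fin mulr_ge0 ?ltW// prodr_gt0// => k _; exact: expR_gt0.
have mprod n : measurable_fun setT (fun w => \prod_(k < n) h (X k w)).
  by apply: measurable_prod => k _; exact: measurableT_comp.
have mW n : measurable_fun setT (W_ n).
  by apply/measurable_EFinP; exact: measurable_funM.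
exists (fun w => \sum_(n <oo) W_ n w)%E; split.
- exact: ge0_emeasurable_sum.
- by move=> w; apply: nneseries_ge0.
- rewrite integral_nneseries//.
  rewrite (eq_eseriesr (g := fun n => (C * q ^+ n)%:E)).
    exact: geometric_nneseries_lty (ltW C0) q0 q1.
  move=> n _; rewrite /W_; under eq_integral do rewrite EFinM.
  rewrite ge0_integralZl_EFin//; last 3 first.
  - by move=> w _; rewrite lee_fin prodr_ge0.
  - exact/measurable_EFinP.
  - exact: ltW.
  rewrite (@integral_prod_indep n (fun=> h) (fun=> q))//; last first.
    by move=> k; rewrite integral_id_distributed.
  by rewrite prodr_const card_ord.
- move=> w n gn; apply: (@le_trans _ _ (W_ n w)); last first.
    apply: le_trans (nneseries_lim_ge n.+1 (P := xpredT) _) => //.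
    by rewrite big_nat_recr//= leeDr// sume_ge0.
  rewrite lee_fin -expR_sum -mulr_sumr -ler_pdivrMl// invrK.
  apply: (@le_trans _ _ (l * \sum_(k < n) y (X k w))); last first.
    by have := expR_ge1Dx (l * \sum_(k < n) y (X k w)); lra.
  rewrite -mulrA ler_pM2l// big_split/= sumr_const card_ord.
  by rewrite mulr_natr lerDr.
Qed.

End IndependentProducts.

(** * From failing slots to the expectation of [Z] *)

Lemma Zfirst_le (R : realType) (S A : finType) (Omega : Type)
    (beta : nat -> Omega -> {ffun S -> A}) (bstar : {ffun S -> A}) w (y : \bar R) :
  (1 <= y)%E ->
  (forall n, (1 <= n)%N -> beta n w != bstar -> (n.+1%:R%:E <= y)%E) ->
  (Zfirst R beta bstar w <= y)%E.
Proof.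
case: y => [r||]; [|by move=> _ _; exact: leey|by rewrite leeNy_eq].
move=> r1 bad.
pose good z := `[<(1 <= z)%N /\ forall t, (z <= t)%N -> beta t w = bstar>].
have /ex_minnP[z /asboolP[z1 zgood] zmin] : exists z, good z.
  (* A failing slot this late would exceed the bound [r]. *)
  exists (Num.truncn r).+1; apply/asboolP; split => // t rt.
  apply/eqP/negPn/negP => /(bad t (leq_ltn_trans (leq0n _) rt)).
  rewrite lee_fin leNgt => /negP; apply.
  by rewrite (lt_le_trans (truncnS_gt r))// ler_nat (leq_trans rt).
apply: (@le_trans _ _ z%:R%:E).
  by apply: ereal_inf_lbound; exists z.
(* If the least good slot is not the first, minimality makes its predecessor fail, and [bad] at the
   predecessor bounds the slot itself. *)
case: z => [//|[|z]] in z1 zgood zmin *; first exact: r1.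
suff : beta z.+1 w != bstar by exact: bad.
apply/negP => /eqP bz.
suff /zmin : good z.+1 by rewrite ltnn.
apply/asboolP; split => // t; rewrite leq_eqVlt => /predU1P[<-//|].
exact: zgood.
Qed.

Theorem theorem3
  (R : realType) (S A : finType)
  (As : S -> {set A}) (Ptr : S -> A -> S -> R)
  (d d' : measure_display) (Omega : measurableType d) (T : measurableType d')
  (P : probability Omega R) (X : nat -> Omega -> T) (f : S -> A -> T -> R)
  (bstar : {ffun S -> A})
  (sol : nat -> Omega -> S -> A -> R) (beta : nat -> Omega -> {ffun S -> A}) :
  (* MDP *)
  (forall s, exists a, a \in As s) ->
  (forall s a s', a \in As s -> 0 <= Ptr s a s') ->
  (forall s a, a \in As s -> \sum_(s' : S) Ptr s a s' = 1) ->
  ergodic As Ptr ->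
  (* i.i.d. exogenous variables and bounded measurable rewards *)
  iid P X ->
  (forall s a, measurable_fun setT (f s a)) ->
  (forall s a, exists C : R, forall x, `|f s a x| <= C) ->
  (* beta* is the optimal policy and Delta_1 > 0, with
     mu(s,a) = E[f(s,a,X_0)] *)
  let M := fun s a => fine (\int[P]_w (f s a (X 0%N w))%:E) in
  admissible As bstar ->
  (forall b, admissible As b -> b != bstar ->
     forall pib pis, stationary Ptr b pib -> stationary Ptr bstar pis ->
       rho b pib M < rho bstar pis M) ->
  (* LPSM: at each slot n >= 1, sol n is an optimal solution of LP(Theta_n)
     and beta n s is an argmax of sol n s over the allowed actions *)
  (forall n w, (1 <= n)%N -> LP_optimal As Ptr (Theta_emp f X n w) (sol n w)) ->
  (forall n w s, (1 <= n)%N -> beta n w s \in As s /\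
     forall a, a \in As s -> sol n w s a <= sol n w s (beta n w s)) ->
  (* E[Z] < oo (as an outer expectation: Z is dominated by a measurable
     random variable with finite expectation) *)
  exists Y : Omega -> \bar R, measurable_fun setT Y /\
    (forall w, (Zfirst R beta bstar w <= Y w)%E) /\
    (\int[P]_w Y w < +oo)%E.
Proof.
move=> _ P0 P1 erg [mX [indX idX]] mf bf M adm opt solO greedy.
have [e e0 near] := greedy_optimal_near P0 P1 erg adm opt.
(* One variable per entry and sign, of mean [- e]; its sum over [k < n] is nonnegative exactly when
   the signed deviation of the empirical mean is at least [e] (for [n >= 1]). *)
pose g (i : S * A * bool) x : R :=
  (-1) ^+ i.2 * (f i.1.1 i.1.2 x - M i.1.1 i.1.2) - e.
have /choice[W WP] : forall i, exists W : Omega -> \bar R, [/\ measurable_fun setT W,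
    forall w, (0 <= W w)%E, (\int[P]_w W w < +oo)%E &
    forall w n, 0 <= \sum_(k < n) g i (X k w) -> (n%:R%:E <= W w)%E].
  case=> -[s a] b; have [C fC] := bf s a.
  have mfX : measurable_fun setT (f s a \o X 0%N) by exact: measurableT_comp.
  have ifX : P.-integrable setT (EFin \o (f s a \o X 0%N)).
    exact: (bounded_integrable P mfX (fun w => fC _)).
  (* Bounded rewards are integrable, so [fine] in [M] does not hit its default value. *)
  have EM : (\int[P]_w (f s a (X 0%N w))%:E)%E = (M s a)%:E.
    by rewrite fineK//; exact: integrable_fin_num ifX.
  have sg1 : `|(-1) ^+ b : R| = 1 by rewrite normrX normrN1 expr1n.
  apply: (exceptional_times_dominated mX indX (c := `|C| + `|M s a| + e) (m := e)) => //.
  - apply: measurable_funB => //; apply: measurable_funM => //.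
    exact: measurable_funB.
  - move=> x; rewrite /g/= (le_trans (ler_normB _ _))// (gtr0_norm e0) lerD2r.
    rewrite normrM sg1 mul1r (le_trans (ler_normB _ _))// lerD2r.
    by rewrite (le_trans (fC x))// ler_norm.
  - by rewrite ltr_wpDl// addr_ge0.
  - pose c := (-1) ^+ b * M s a + e.
    under eq_integral => w _.
      rewrite (_ : g _ _ = (-1) ^+ b * f s a (X 0%N w) + - c); last first.
        by rewrite /g /c /=; ring.
      rewrite EFinD EFinM; over.
    rewrite integralD//=; last 2 first.
    - exact: integrableZl.
    - exact: finite_measure_integrable_cst.
    rewrite integral_probability_cst integralZl// EM -EFinM -EFinD.
    by congr EFin; rewrite /c; ring.
have W0 i w : (0 <= W i w)%E by have [] := WP i.
have mW i : measurable_fun setT (W i) by have [] := WP i.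
(* The [1] accounts for [Z] being one past the last failing slot, and for [Z = 1] when none
   fails. *)
exists (fun w => 1 + \sum_i W i w)%E; split; [|split].
- by apply: emeasurable_funD => //; exact: emeasurable_sum.
- move=> w; apply: Zfirst_le; first by rewrite leeDl// sume_ge0.
  move=> n n1 bad.
  suff [i gi] : exists i, 0 <= \sum_(k < n) g i (X k w).
    rewrite -natr1 addrC EFinD leeD2l//; have [_ _ _ Wi] := WP i.
    rewrite (le_trans (Wi _ _ gi))// (bigD1 i)//= leeDl// sume_ge0//.
  have sumg s a b : \sum_(k < n) g (s, a, b) (X k w) =
      n%:R * ((-1) ^+ b * (Theta_emp f X n w s a - M s a) - e).
    have n0 : n%:R != 0 :> R by rewrite pnatr_eq0 -lt0n.
    rewrite /g /Theta_emp/= sumrB -mulr_sumr sumrB !sumr_const card_ord.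
    by rewrite -[M s a *+ n]mulr_natl -[e *+ n]mulr_natl; field.
  apply: contrapT => /forallNP none; move/eqP: bad; apply.
  apply: (near (Theta_emp f X n w) (sol n w)); last 2 first.
  - exact: solO.
  - by move=> s; exact: greedy.
  have lt_e s a (b : bool) : (-1) ^+ b * (Theta_emp f X n w s a - M s a) < e.
    rewrite -subr_lt0 ltNge; apply/negP => ge0; apply: (none (s, a, b)).
    by rewrite sumg mulr_ge0.
  move=> s a; rewrite ler_norml; have := lt_e s a false; have := lt_e s a true.
  by rewrite expr1 expr0 mulN1r mul1r; lra.
- rewrite ge0_integralD//; last 2 first.
  - by move=> w _; apply: sume_ge0.
  - exact: emeasurable_sum.
  rewrite ge0_integral_sum// integral_probability_cst.
  rewrite lte_add_pinfty ?ltry//; apply: lte_sum_pinfty => i _.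
  by have [] := WP i.
Qed.
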